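(* Let $E=\mathbb R^m$ with $m>1$, let $(\mathbf S_n)$ be a sequence in $E$, $\mathbf S\in E$, $\mathbf y$ a linear functional on $E$, and $k\ge 0$ a fixed integer. Let $\boldsymbol{\widehat\varepsilon}_{2k}^{(n)}$ be the first topological Shanks transforms of $(\mathbf S_n)$ with respect to $\mathbf y$, let $\varepsilon_k^{(n)}$ be the scalars given by the scalar $\varepsilon$-algorithm applied to $(\langle\mathbf y,\mathbf S_n\rangle)$, and set $$r_k^{(n)}=\frac{\varepsilon_{2k+2}^{(n)}-\varepsilon_{2k}^{(n+1)}}{\varepsilon_{2k}^{(n+1)}-\varepsilon_{2k}^{(n)}}.$$ Assume that, as $n\to\infty$, $r_k^{(n)}=r_k+o(1)$ with $r_k\ne -1$, and that for every component $i$, $$(\boldsymbol{\widehat\varepsilon}_{2k}^{(n+1)}-\mathbf S)_i/(\boldsymbol{\widehat\varepsilon}_{2k}^{(n)}-\mathbf S)_i=r_k/(1+r_k)+o(1).$$ Then $$\lim_{n\to\infty}\|\boldsymbol{\widehat\varepsilon}_{2k+2}^{(n)}-\mathbf S\|/\|\boldsymbol{\widehat\varepsilon}_{2k}^{(n)}-\mathbf S\|=0.$$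
   Context: First topological Shanks transforms: with $\Delta\mathbf S_n=\mathbf S_{n+1}-\mathbf S_n$, for $k,n\ge 0$ let $a_0^{(n,k)},\ldots,a_k^{(n,k)}\in\mathbb R$ be the solution of $\sum_{i=0}^k a_i^{(n,k)}=1$ and $\sum_{i=0}^k a_i^{(n,k)}\langle\mathbf y,\Delta\mathbf S_{n+j+i}\rangle=0$ for $j=0,\ldots,k-1$. Then $\boldsymbol{\widehat\varepsilon}_{2k}^{(n)}=a_0^{(n,k)}\mathbf S_n+\cdots+a_k^{(n,k)}\mathbf S_{n+k}$. Scalar $\varepsilon$-algorithm applied to a sequence of numbers $(S_n)$: $\varepsilon_{-1}^{(n)}=0$, $\varepsilon_0^{(n)}=S_n$, $\varepsilon_{k+1}^{(n)}=\varepsilon_{k-1}^{(n+1)}+(\varepsilon_k^{(n+1)}-\varepsilon_k^{(n)})^{-1}$ for $k,n=0,1,\ldots$. $(\mathbf v)_i$ denotes the $i$-th component of $\mathbf v\in\mathbb R^m$ and $\|\cdot\|$ is any norm on $\mathbb R^m$. All quantities involved are assumed to be defined (the linear systems are uniquely solvable and the denominators are nonzero). *)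

(* Defs.v *)
From mathcomp Require Import all_boot all_order all_algebra.
From mathcomp Require Import all_classical all_reals all_analysis.

Set Implicit Arguments.
Unset Strict Implicit.
Unset Printing Implicit Defensive.

Import Order.TTheory GRing.Theory Num.Theory.
Import numFieldNormedType.Exports.

Local Open Scope classical_set_scope.
Local Open Scope ring_scope.

(* [a i 0] is the coefficient a_i^(n,k) of the first topological Shanks
   transform. *)
Definition shanks_system (R : realType) (m : nat) (y : {scalar 'rV[R]_m})
    (S : nat -> 'rV[R]_m) (k n : nat) (a : 'cV[R]_k.+1) : Prop :=
  \sum_(i < k.+1) a i 0 = 1 /\
  forall j : nat, (j < k)%N ->
    \sum_(i < k.+1) a i 0 * y (S (n + j + i).+1 - S (n + j + i)%N) = 0.

(* Meaningful only when the system is uniquely solvable; the default value 0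
   is returned when it has no solution. *)
Definition shanks_coef (R : realType) (m : nat) (y : {scalar 'rV[R]_m})
    (S : nat -> 'rV[R]_m) (k n : nat) : 'cV[R]_k.+1 :=
  xget 0 [set a | shanks_system y S n a].

(* The vector usually written \hat\varepsilon_{2k}^{(n)}: the argument [k] is
   half of the lower index. *)
Definition top_shanks (R : realType) (m : nat) (y : {scalar 'rV[R]_m})
    (S : nat -> 'rV[R]_m) (k n : nat) : 'rV[R]_m :=
  \sum_(i < k.+1) shanks_coef y S k n i 0 *: S (n + i)%N.

(* Lower indices are shifted by one, so that [eps_shift s 0] is the column
   \varepsilon_{-1}. *)
Fixpoint eps_shift (R : realType) (s : nat -> R) (k : nat) : nat -> R :=
  match k with
  | 0 => fun=> 0
  | 1 => s
  | (k''.+1 as k').+1 => fun n =>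
      eps_shift s k'' n.+1 + (eps_shift s k' n.+1 - eps_shift s k' n)^-1
  end.

Definition scalar_eps (R : realType) (s : nat -> R) (k n : nat) : R :=
  eps_shift s k.+1 n.

Definition shanks_ratio (R : realType) (s : nat -> R) (k n : nat) : R :=
  (scalar_eps s (2 * k + 2) n - scalar_eps s (2 * k) n.+1) /
  (scalar_eps s (2 * k) n.+1 - scalar_eps s (2 * k) n).

(* An arbitrary norm on R^m, not necessarily the sup norm that the library
   attaches to row vectors; nonnegativity follows from these three axioms. *)
Definition is_norm (R : realType) (m : nat) (N : 'rV[R]_m -> R) : Prop :=
  [/\ forall u v, N (u + v) <= N u + N v,
      forall c u, N (c *: u) = `|c| * N u
    & forall u, N u = 0 -> u = 0].

(* Main.v *)
(* Writing e_j^n for the scalar epsilon table of s_n = <y, S_n>, one has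
     \hat\varepsilon_{2k+2}^(n) = (1 + r_k^(n)) \hat\varepsilon_{2k}^(n+1)
                                  - r_k^(n) \hat\varepsilon_{2k}^(n).
   To see this, encode a combination sum_i a_i S_(n+i) by the polynomial
   sum_i a_i X^i, so that multiplication by X is the shift n -> n+1. Run
   Wynn's recursion on polynomials: P_k^n of degree <= k, with value 1 at 1,
   and D_k^n, starting from P_0^n = 1, D_(-1)^n = 0. They satisfy
     X P_k^(n+1) - P_k^n = (e_2k^(n+1) - e_2k^n) (X - 1) D_k^n,
     D_k^(n+1) - D_k^n = (e_(2k+1)^(n+1) - e_(2k+1)^n) P_k^(n+1),
   and, by induction on k, these identities make P_k^n annihilate
   Delta s_(n+j) for j < k while D_k^n takes it to 1 for j <= k, so that the
   coefficients of P_k^n solve the Shanks system. The component ratios then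
   tend to (1 + r) r / (1 + r) - r = 0, and equivalence with the sup norm gives
   the claim for any norm. *)

Require Import Defs.
From mathcomp Require Import all_boot all_order all_algebra.
From mathcomp Require Import all_classical all_reals all_analysis.
From mathcomp Require Import ring lra.
Import Order.TTheory GRing.Theory Num.Theory.
Import numFieldNormedType.Exports.
Local Open Scope classical_set_scope.
Local Open Scope ring_scope.

(** * Polynomials acting on sequences as shift operators *)

(** This is [(p(E) u)_n], with [E] the shift. Values lie in any module, so that one polynomial acts
    both on the scalar differences and on the vectors [S n]. *)
Definition shift_eval {R : realType} {V : lmodType R} (u : nat -> V)
    (p : {poly R}) (n : nat) : V :=
  \sum_(i < size p) p`_i *: u (n + i)%N.

Lemma shift_evalE (R : realType) (V : lmodType R) (u : nat -> V)
    (p : {poly R}) (n d : nat) : (size p <= d)%N ->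
  shift_eval u p n = \sum_(i < d) p`_i *: u (n + i)%N.
Proof.
move=> pd; rewrite /shift_eval.
rewrite (big_ord_widen d (fun i => p`_i *: u (n + i)%N) pd) big_mkcond /=.
apply: eq_bigr => i _; case: ltnP => // ip.
by rewrite nth_default// scale0r.
Qed.

Lemma shift_evalD (R : realType) (V : lmodType R) (u : nat -> V)
    (p q : {poly R}) (n : nat) :
  shift_eval u (p + q) n = shift_eval u p n + shift_eval u q n.
Proof.
pose d := maxn (size p) (size q).
rewrite (shift_evalE _ _ _ (p + q) _ d) ?size_polyD//.
rewrite (shift_evalE _ _ _ p _ d) ?leq_maxl//.
rewrite (shift_evalE _ _ _ q _ d) ?leq_maxr// -big_split /=.
by apply: eq_bigr => i _; rewrite coefD scalerDl.
Qed.

Lemma shift_evalC (R : realType) (V : lmodType R) (u : nat -> V) (c : R)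
    (p : {poly R}) (n : nat) :
  shift_eval u (c%:P * p) n = c *: shift_eval u p n.
Proof.
rewrite mul_polyC (shift_evalE _ _ _ _ _ (size p)) ?size_scale_leq//.
by rewrite scaler_sumr; apply: eq_bigr => i _; rewrite coefZ scalerA.
Qed.

Lemma shift_evalN (R : realType) (V : lmodType R) (u : nat -> V)
    (p : {poly R}) (n : nat) :
  shift_eval u (- p) n = - shift_eval u p n.
Proof. by rewrite -mulN1r -polyCN shift_evalC scaleN1r. Qed.

Lemma shift_evalX (R : realType) (V : lmodType R) (u : nat -> V)
    (p : {poly R}) (n : nat) :
  shift_eval u ('X * p) n = shift_eval u p n.+1.
Proof.
rewrite mulrC (shift_evalE _ _ _ _ _ (size p).+1); last first.
  by rewrite (leq_trans (size_polyMleq _ _))// size_polyX addn2.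
rewrite big_ord_recl coefMX scale0r add0r; apply: eq_bigr => i _.
by rewrite coefMX /= /bump/= !add1n addnS addSn.
Qed.

(** * The polynomial form of the epsilon table *)

Definition delta_eps {R : realType} (s : nat -> R) (j n : nat) : R :=
  scalar_eps s j n.+1 - scalar_eps s j n.

Lemma delta_eps1 (R : realType) (s : nat -> R) (n : nat) :
  delta_eps s 1 n = (delta_eps s 0 n.+1)^-1 - (delta_eps s 0 n)^-1.
Proof. by rewrite /delta_eps /scalar_eps /= !add0r. Qed.

Lemma scalar_epsSS (R : realType) (s : nat -> R) (j n : nat) :
  scalar_eps s j.+2 n = scalar_eps s j n.+1 + (delta_eps s j.+1 n)^-1.
Proof. by []. Qed.

Lemma delta_epsSS (R : realType) (s : nat -> R) (j n : nat) :
  delta_eps s j.+2 n =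
  delta_eps s j n.+1 + (delta_eps s j.+1 n.+1)^-1
    - (delta_eps s j.+1 n)^-1.
Proof.
rewrite {1}/delta_eps !scalar_epsSS [delta_eps s j n.+1]/delta_eps; ring.
Qed.

(* The pair at [k], [n] is (P_k^n, D_k^n); P_k^n applied to [s] at [n] is
   \varepsilon_{2k}^{(n)} and D_k^n evaluated at 1 is
   \varepsilon_{2k+1}^{(n)}. *)
Fixpoint shanks_polys {R : realType} (s : nat -> R) (k n : nat) :
    {poly R} * {poly R} :=
  match k with
  | 0 => (1, ((delta_eps s 0 n)^-1)%:P)
  | k'.+1 =>
      let P := 'X * (shanks_polys s k' n.+1).1
        + ((delta_eps s k'.*2.+1 n)^-1)%:P
            * (('X - 1) * (shanks_polys s k' n).2) in
      (P, 'X * (shanks_polys s k' n.+1).2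
            + ((delta_eps s k'.*2.+2 n)^-1)%:P * P)
  end.

(** The two identities go through a single induction, since each one at [k.+1] draws on both at
    [k]. *)
Lemma shanks_polys_diff (R : realType) (s : nat -> R) (k : nat) :
  (forall j n, (j <= k.*2)%N -> delta_eps s j n != 0) ->
  forall n,
    'X * (shanks_polys s k n.+1).1 - (shanks_polys s k n).1
      = (delta_eps s k.*2 n)%:P * (('X - 1) * (shanks_polys s k n).2)
  /\ (shanks_polys s k n.+1).2 - (shanks_polys s k n).2
      = (delta_eps s k.*2.+1 n)%:P * (shanks_polys s k n.+1).1.
Proof.
elim: k => [|k IH] e_neq0 n.
  have e0 := e_neq0 0%N n (leqnn _); split=> /=.
    by rewrite mulr1 mulrCA -polyCM divff// mulr1.
  by rewrite mulr1 -polyCB -delta_eps1.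
have {}IH := IH (fun j n jk => e_neq0 j n (leq_trans jk (leqW (leqnSn _)))).
have cV j n' : (j <= k.+1.*2)%N ->
    (delta_eps s j n')%:P * ((delta_eps s j n')^-1)%:P = 1 :> {poly R}.
  by move=> jk; rewrite -polyCM divff// e_neq0.
(* Both identities at [k.+1] follow from this intermediate one, in which [X] does not multiply
   [P_(k+1)^(n+1)]. *)
have PB : (shanks_polys s k.+1 n.+1).1 - (shanks_polys s k.+1 n).1
    = (delta_eps s k.*2.+2 n)%:P * (('X - 1) * (shanks_polys s k n.+1).2).
  have [I _] := IH n.+1; have [_ J] := IH n.
  have V := cV k.*2.+1 n (leqnSn _).
  rewrite delta_epsSS polyCB polyCD /=.
  move/eqP: I; rewrite subr_eq => /eqP ->.
  have -> : (shanks_polys s k n).2 = (shanks_polys s k n.+1).2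
      - (delta_eps s k.*2.+1 n)%:P * (shanks_polys s k n.+1).1.
    by rewrite -J; ring.
  apply/eqP; rewrite -subr_eq0; apply/eqP.
  (* [ring] treats the constant and its inverse as unrelated atoms, so the difference of the sides
     is displayed as a multiple of [d * d^-1 - 1]. The same device recurs below. *)
  transitivity (((delta_eps s k.*2.+1 n)%:P
     * ((delta_eps s k.*2.+1 n)^-1)%:P - 1) * ('X - 1)
     * (shanks_polys s k n.+1).1); last by rewrite V subrr !mul0r.
  ring.
rewrite doubleS; split.
  have V := cV k.*2.+2 n (leqnn _).
  have -> : (shanks_polys s k.+1 n).2 = 'X * (shanks_polys s k n.+1).2
     + ((delta_eps s k.*2.+2 n)^-1)%:P * (shanks_polys s k.+1 n).1 by [].
  move/eqP: PB; rewrite subr_eq => /eqP ->.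
  apply/eqP; rewrite eq_sym -subr_eq0; apply/eqP.
  transitivity (((delta_eps s k.*2.+2 n)%:P
     * ((delta_eps s k.*2.+2 n)^-1)%:P - 1) * ('X - 1)
     * (shanks_polys s k.+1 n).1); last by rewrite V subrr !mul0r.
  ring.
have V := cV k.*2.+2 n (leqnn _).
have [_ J] := IH n.+1.
have V1 := cV k.*2.+1 n.+1 (leqnSn _).
rewrite (delta_epsSS _ _ k.*2.+1) polyCB polyCD.
have -> : (shanks_polys s k.+1 n).2 = 'X * (shanks_polys s k n.+1).2
   + ((delta_eps s k.*2.+2 n)^-1)%:P * (shanks_polys s k.+1 n).1 by [].
have -> : (shanks_polys s k.+1 n.+1).2 = 'X * (shanks_polys s k n.+2).2
   + ((delta_eps s k.*2.+2 n.+1)^-1)%:P * (shanks_polys s k.+1 n.+1).1.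
  by [].
have -> : (shanks_polys s k.+1 n).1 = (shanks_polys s k.+1 n.+1).1
    - (delta_eps s k.*2.+2 n)%:P * (('X - 1) * (shanks_polys s k n.+1).2).
  by rewrite -PB; ring.
have -> : (shanks_polys s k n.+2).2 = (shanks_polys s k n.+1).2
    + (delta_eps s k.*2.+1 n.+1)%:P * (shanks_polys s k n.+2).1.
  by rewrite -J; ring.
rewrite [(shanks_polys s k.+1 n.+1).1]/=.
apply/eqP; rewrite -subr_eq0; apply/eqP.
transitivity (((delta_eps s k.*2.+2 n)%:P
     * ((delta_eps s k.*2.+2 n)^-1)%:P - 1) * ('X - 1)
     * (shanks_polys s k n.+1).2
   - ((delta_eps s k.*2.+1 n.+1)%:P
     * ((delta_eps s k.*2.+1 n.+1)^-1)%:P - 1) * ('X - 1)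
     * (shanks_polys s k n.+1).2); last by rewrite V V1 subrr.
ring.
Qed.

Lemma size_shanks_polys (R : realType) (s : nat -> R) (k n : nat) :
  (size (shanks_polys s k n).1 <= k.+1)%N /\
  (size (shanks_polys s k n).2 <= k.+1)%N.
Proof.
elim: k n => [|k IH] n; first by rewrite /= size_poly1 size_polyC leq_b1.
have sX (p : {poly R}) : (size p <= k.+1)%N -> (size ('X * p)%R <= k.+2)%N.
  move=> pk; rewrite mulrC (leq_trans (size_polyMleq _ _))//.
  by rewrite size_polyX addn2.
have sD (p q : {poly R}) d :
    (size p <= d -> size q <= d -> size (p + q)%R <= d)%N.
  by move=> pd qd; rewrite (leq_trans (size_polyD _ _))// geq_max pd.
have sC (c : R) (p : {poly R}) d : (size p <= d -> size (c%:P * p)%R <= d)%N.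
  by rewrite mul_polyC; exact: (leq_trans (size_scale_leq _ _)).
have [[P1 D1] [_ D0]] := (IH n.+1, IH n).
suff sP : (size (shanks_polys s k.+1 n).1 <= k.+2)%N.
  by split=> //=; apply: (sD); [exact: sX | exact: sC].
apply: (sD); first exact: sX.
apply: (sC); rewrite mulrBl mul1r; apply: (sD); first exact: sX.
by rewrite size_polyN leqW.
Qed.

Lemma shanks_polys_sum1 (R : realType) (s : nat -> R) (k n : nat) :
  (shanks_polys s k n).1.[1] = 1.
Proof.
elim: k n => [|k IH] n; first by rewrite hornerC.
by rewrite /= !hornerE !IH subrr /= mulr0 mul0r addr0.
Qed.

(** Where [D_k^n] is constantly 1, the factor ['X - 1] kills it; only the last index of each range
    calls for a difference identity. Column [2k] has its own premise because its inverses enter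
    [D_k^n] but not [P_k^n]. *)
Lemma shanks_polys_ortho (R : realType) (s : nat -> R) (k : nat)
    (ds : nat -> R^o := fun i => s i.+1 - s i) :
  (forall j n, (j < k.*2)%N -> delta_eps s j n != 0) ->
  (forall n j, (j < k)%N ->
     shift_eval ds (shanks_polys s k n).1 (n + j) = 0) /\
  ((forall n, delta_eps s k.*2 n != 0) ->
   forall n j, (j <= k)%N ->
     shift_eval ds (shanks_polys s k n).2 (n + j) = 1).
Proof.
elim: k => [|k IH] e_neq0.
  split=> // e0_neq0 n j; rewrite leqn0 => /eqP ->; rewrite /= addn0.
  rewrite -[_%:P]mulr1 shift_evalC (shift_evalE _ _ _ _ _ 1) ?size_poly1//.
  by rewrite big_ord1 coef1/= scale1r addn0 /ds; apply: mulVf; exact: e0_neq0.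
have e_neq0' j n' : (j <= k.*2)%N -> delta_eps s j n' != 0.
  by move=> jk; apply: e_neq0; rewrite doubleS ltnS (leq_trans jk).
have {IH} [P0 D1] := IH (fun j n jk => e_neq0' j n (ltnW jk)).
have {}D1 := D1 (fun n => e_neq0' _ n (leqnn _)).
have Portho n j : (j < k.+1)%N ->
    shift_eval ds (shanks_polys s k.+1 n).1 (n + j) = 0.
  rewrite ltnS leq_eqVlt /= shift_evalD shift_evalC shift_evalX mulrBl.
  rewrite shift_evalD shift_evalX mul1r shift_evalN -addSn.
  (* For [j = k], the value of [D_k^n] at [n + k + 1] is beyond the induction hypothesis. The second
     difference identity expresses it through [P_k^(n+1)], and the two terms cancel. *)
  case/predU1P => [->|jk]; last first.
    by rewrite P0// D1 ?(ltnW jk)// addSnnS D1// subrr scaler0 addr0.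
  have [_ J] := shanks_polys_diff R s k e_neq0' n.
  have := congr1 (fun p => shift_eval ds p (n.+1 + k)) J.
  rewrite /= shift_evalD shift_evalN shift_evalC D1// D1// => JE.
  rewrite -[X in _ *: X]opprB JE scalerN scalerA mulVf ?scale1r ?subrr//.
  by apply: e_neq0; rewrite doubleS.
split=> // eS_neq0 n.
have Dlow j : (j <= k)%N ->
    shift_eval ds (shanks_polys s k.+1 n).2 (n + j) = 1.
  move=> jk; rewrite [(shanks_polys s k.+1 n).2]/=.
  rewrite shift_evalD shift_evalX shift_evalC Portho// scaler0 addr0 -addSn.
  exact: D1.
(* For [j = k + 1], the left side of the first difference identity vanishes at [n + k], so
   [D_(k+1)^n] takes equal values at [n + k] and [n + k + 1]. *)
move=> j; rewrite leq_eqVlt ltnS => /predU1P[->|]; last exact: Dlow.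
have [|I _] := shanks_polys_diff R s k.+1 _ n.
  by move=> i p; rewrite leq_eqVlt => /predU1P[->|/e_neq0].
have := congr1 (fun p => shift_eval ds p (n + k)) I.
rewrite [LHS]shift_evalD shift_evalN shift_evalX -addSn !Portho// subrr.
rewrite shift_evalC mulrBl mul1r shift_evalD shift_evalN shift_evalX Dlow//.
move=> /esym/eqP; rewrite scaler_eq0 (negbTE (eS_neq0 _)).
by rewrite /= subr_eq0 addnS => /eqP.
Qed.

(** * Topological Shanks transforms and their recurrence *)

(** The coefficients of [P_k^n] solve the Shanks system, so by uniqueness they are those picked by
    [xget]. *)
Lemma top_shanksE (R : realType) (m : nat) (y : {scalar 'rV[R]_m})
    (S : nat -> 'rV[R]_m) (k n : nat) :
  (exists! a : 'cV[R]_k.+1, shanks_system y S n a) ->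
  (forall j p, (j < k.*2)%N -> delta_eps (fun i => y (S i)) j p != 0) ->
  top_shanks y S k n
    = shift_eval S (shanks_polys (fun i => y (S i)) k n).1 n.
Proof.
set s := fun i => y (S i) => [[a [sysa uniqa]]] e_neq0.
have [sP _] := size_shanks_polys R s k n.
rewrite (shift_evalE _ _ _ _ _ _ sP) /top_shanks.
have -> : shanks_coef y S k n = a.
  by apply: xget_unique => // b sysb; rewrite (uniqa b).
suff -> : a = \col_(i < k.+1) (shanks_polys s k n).1`_i.
  by apply: eq_bigr => i _; rewrite mxE.
apply: uniqa; split=> [|j jk].
  rewrite -[RHS](shanks_polys_sum1 R s k n) (horner_coef_wide _ sP).
  by apply: eq_bigr => i _; rewrite mxE expr1n mulr1.
rewrite -[RHS]((shanks_polys_ortho R s k e_neq0).1 n j jk).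
rewrite (shift_evalE _ _ _ _ _ _ sP).
by apply: eq_bigr => i _; rewrite mxE raddfB.
Qed.

(** Eliminating [D_k^n] between the definition of [P_(k+1)^n] and the first difference identity
    leaves a relation among the [P] alone, which is then applied to [S]. *)
Lemma top_shanks_recurrence (R : realType) (m : nat) (y : {scalar 'rV[R]_m})
    (S : nat -> 'rV[R]_m) (k : nat) (r := shanks_ratio (fun p => y (S p)) k) :
  (forall n, exists! a : 'cV[R]_k.+1, shanks_system y S n a) ->
  (forall n, exists! a : 'cV[R]_k.+2, shanks_system y S n a) ->
  (forall j n, (j <= k.*2.+1)%N -> delta_eps (fun i => y (S i)) j n != 0) ->
  forall n, top_shanks y S k.+1 n
    = (1 + r n) *: top_shanks y S k n.+1 - r n *: top_shanks y S k n.
Proof.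
set s := fun i => y (S i) => solk solk1 e_neq0 n.
have e_neq0' j p : (j <= k.*2)%N -> delta_eps s j p != 0.
  by move=> jk; apply: e_neq0; rewrite leqW.
have -> : r n = (delta_eps s k.*2.+1 n)^-1 / delta_eps s k.*2 n.
  rewrite /r /shanks_ratio mul2n addn2 scalar_epsSS.
  by rewrite addrC addKr.
rewrite (top_shanksE _ _ _ _ k.+1)//.
rewrite !(top_shanksE _ _ _ _ k)//; try by move=> j p /ltnW; exact: e_neq0'.
have [I _] := shanks_polys_diff R s k e_neq0' n.
rewrite -!shift_evalX -!shift_evalC -shift_evalN -shift_evalD; congr shift_eval.
rewrite /= -/s; set i1 := (_ ^-1); set d := delta_eps s k.*2 n.
have -> : ('X - 1) * (shanks_polys s k n).2 = (d^-1)%:P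
    * ('X * (shanks_polys s k n.+1).1 - (shanks_polys s k n).1).
  by rewrite I mulrA -polyCM mulVf ?mul1r// e_neq0'.
rewrite !polyCD !polyCM; ring.
Qed.

(** * Comparison of an arbitrary norm with the sup norm *)

Lemma is_norm0 (R : realType) (m : nat) (N : 'rV[R]_m -> R) :
  is_norm N -> N 0 = 0.
Proof. by move=> [_ NZ _]; rewrite -(scale0r 0) NZ normr0 mul0r. Qed.

Lemma norm_le_sum (R : realType) (m : nat) (N : 'rV[R]_m -> R) (v : 'rV[R]_m) :
  is_norm N -> N v <= \sum_(i < m) `|v 0 i| * N 'e_i.
Proof.
move=> HN; have [ND NZ _] := HN; rewrite {1}[v]row_sum_delta.
elim/big_ind2 : _ => [|x1 x2 y1 y2 le1 le2|i _]; last by rewrite NZ.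
  by rewrite is_norm0.
by rewrite (le_trans (ND _ _))// lerD.
Qed.

Lemma is_norm_ge0 (R : realType) (m : nat) (N : 'rV[R]_m -> R) (v : 'rV[R]_m) :
  is_norm N -> 0 <= N v.
Proof.
move=> HN; have [ND NZ _] := HN; have := ND v (- v).
rewrite subrr is_norm0// -scaleN1r NZ normrN1 mul1r; lra.
Qed.

Lemma coord_le_mx_norm (R : realType) (m : nat) (v : 'rV[R]_m) (i : 'I_m) :
  `|v 0 i| <= `|v|.
Proof.
rewrite [leRHS]/Num.norm /= mx_normrE.
exact: (le_bigmax _ (fun ij : 'I_1 * 'I_m => `|v ij.1 ij.2|) (0, i)).
Qed.

Lemma is_norm_continuous (R : realType) (m : nat) (N : 'rV[R]_m -> R) :
  is_norm N -> continuous N.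
Proof.
move=> HN v; have [ND NZ _] := HN.
apply/(@cvgrPdist_le _ _ _ (nbhs v)) => /= e e0.
pose C := \sum_(i < m) N ('e_i : 'rV[R]_m).
have C0 : 0 <= C by apply: sumr_ge0 => i _; exact: is_norm_ge0.
have NC u : N u <= `|u| * C.
  rewrite (le_trans (norm_le_sum _ _ _ u HN))// mulr_sumr ler_sum// => i _.
  rewrite ler_wpM2r ?is_norm_ge0// [leRHS]/Num.norm /= mx_normrE.
  exact: (le_bigmax _ (fun ij : 'I_1 * 'I_m => `|u ij.1 ij.2|) (0, i)).
near=> u.
(* Dividing by [C + 1] avoids the case [C = 0], which occurs for [m = 0]. *)
have uv : `|v - u| * C <= e.
  rewrite (le_trans (_ : _ <= `|v - u| * (C + 1)))//.
    by rewrite ler_wpM2l// lerDl.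
  rewrite -ler_pdivlMr ?ltr_wpDl//.
  near: u; apply: cvgr_dist_le => //.
  by rewrite divr_gt0// ltr_wpDl.
have := ND (v - u) u; have := ND (u - v) v; rewrite !subrK.
have := NC (v - u); have := NC (u - v); rewrite distrC => H1 H2 H3 H4.
by rewrite ler_norml; apply/andP; split; lra.
Unshelve. all: by end_near. Qed.

(** By compactness [N] attains a positive minimum on the sup-norm unit sphere; its inverse serves as
    [C]. *)
Lemma coord_le_norm (R : realType) (m : nat) (N : 'rV[R]_m -> R) :
  is_norm N -> exists C, forall (v : 'rV[R]_m) i, `|v 0 i| <= C * N v.
Proof.
move=> HN; have [_ NZ N0] := HN.
pose A := [set v : 'rV[R]_m | `|v| = 1].
have cA : compact A.
  apply: bounded_closed_compact.
    by exists 1; split => // M M1 v /= ->; exact: ltW.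
  rewrite (_ : A = Num.norm @^-1` [set 1]); last by [].
  by apply: closed_comp => [v _|]; [exact: norm_continuous | exact: closed_eq].
have scale_A (v : 'rV[R]_m) : v != 0 -> A (`|v|^-1 *: v).
  move=> v0; by rewrite /A/= normrZ normfV normr_id mulVf// normr_eq0.
(* An empty sphere means that every vector is zero, and then [C = 0] works. *)
have [A0|] := pselect (A !=set0); last first.
  move=> A0; exists 0 => v i; have [->|v0] := eqVneq v 0.
    by rewrite mxE normr0 mul0r.
  by exfalso; apply: A0; exists (`|v|^-1 *: v); exact: scale_A.
have [c] := compact_EVT_min A0 cA
  (continuous_subspaceT (is_norm_continuous R m N HN)).
rewrite inE => cA1 cmin.
have Nc : 0 < N c.
  rewrite lt_neqAle is_norm_ge0// andbT eq_sym; apply/eqP => /N0 c0.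
  by move: cA1; rewrite /A/= c0 normr0 => /esym/eqP; rewrite oner_eq0.
exists (N c)^-1 => v i; rewrite (le_trans (coord_le_mx_norm R m v i))//.
have [->|v0] := eqVneq v 0.
  by rewrite normr0 mulr_ge0 ?invr_ge0 ?is_norm_ge0.
have := cmin _ (mem_set (scale_A v v0)).
rewrite NZ normfV normr_id mulrC ler_pdivlMr ?normr_gt0// => H.
by rewrite mulrC ler_pdivlMr// mulrC.
Qed.

(** Squeeze: [N w] is at most the sum of [|w_i / v_i| * |v_i| * N e_i], and each [|v_i|] is at most
    [C * N v]. *)
Lemma norm_ratio_cvg0 (R : realType) (m : nat) (N : 'rV[R]_m -> R)
    (w v : nat -> 'rV[R]_m) :
  is_norm N -> (forall n i, v n 0 i != 0) ->
  (forall i, w n 0 i / v n 0 i @[n --> \oo] --> (0 : R)) ->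
  N (w n) / N (v n) @[n --> \oo] --> (0 : R).
Proof.
move=> HN v0 wv; have [C vC] := coord_le_norm R m N HN.
pose h n := \sum_(i < m) `|w n 0 i / v n 0 i| * (C * N 'e_i).
apply: (@squeeze_cvgr _ _ _ _ (fun=> 0) h); last 2 first.
- exact: cvg_cst.
- rewrite [X in _ --> X](_ : _ = \sum_(i < m) `|0 : R| * (C * N 'e_i)).
    apply: cvg_big => [|i _]; first exact: add_continuous.
    by apply: cvgMl; apply: cvg_norm; exact: wv.
  by rewrite big1// => i _; rewrite normr0 mul0r.
apply: nearW => n; rewrite divr_ge0 ?is_norm_ge0//=.
(* If [N (v n) = 0] the quotient is 0 by convention, and any index [i] would contradict
   [v n 0 i != 0]. *)
have [vn0|vn0] := eqVneq (N (v n)) 0.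
  rewrite vn0 invr0 mulr0; apply: sumr_ge0 => i _.
  by have := vC (v n) i; rewrite vn0 mulr0 normr_le0 (negbTE (v0 n i)).
rewrite ler_pdivrMr ?lt_neqAle ?is_norm_ge0 ?(eq_sym 0) ?vn0//.
rewrite (le_trans (norm_le_sum _ _ _ _ HN))// mulr_suml ler_sum// => i _.
rewrite -[in leLHS](divfK (v0 n i) (w n 0 i)) normrM -!mulrA ler_wpM2l//.
by rewrite mulrCA [leLHS]mulrC ler_wpM2l ?is_norm_ge0 ?vC.
Qed.

Theorem theorem6 (R : realType) (m : nat) (m_gt1 : (1 < m)%N)
    (S : nat -> 'rV[R]_m) (Slim : 'rV[R]_m) (y : {scalar 'rV[R]_m}) (k : nat)
    (N : 'rV[R]_m -> R) (N_norm : is_norm N) (rk : R)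
    (solv_k : forall n, exists! a : 'cV[R]_k.+1, shanks_system y S n a)
    (solv_k1 : forall n, exists! a : 'cV[R]_k.+2, shanks_system y S n a)
    (eps_def : forall j n : nat, (j <= 2 * k + 1)%N ->
       scalar_eps (fun p => y (S p)) j n.+1 - scalar_eps (fun p => y (S p)) j n
         != 0)
    (comp_def : forall (n : nat) (i : 'I_m),
       (top_shanks y S k n - Slim) 0 i != 0)
    (ratio_cvg : shanks_ratio (fun p => y (S p)) k n @[n --> \oo] --> rk)
    (rk_neqN1 : rk != -1)
    (comp_cvg : forall i : 'I_m,
       (top_shanks y S k n.+1 - Slim) 0 i / (top_shanks y S k n - Slim) 0 i
         @[n --> \oo] --> rk / (1 + rk)) :
  N (top_shanks y S k.+1 n - Slim) / N (top_shanks y S k n - Slim)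
    @[n --> \oo] --> (0 : R).
Proof.
apply: norm_ratio_cvg0 => // i.
pose r n := shanks_ratio (fun p => y (S p)) k n.
pose q n :=
  (top_shanks y S k n.+1 - Slim) 0 i / (top_shanks y S k n - Slim) 0 i.
have rk1 : 1 + rk != 0 by rewrite addrC -[1]opprK subr_eq0.
(* The weights [1 + r n] and [- r n] sum to 1, so the recurrence also holds for the errors, after
   subtraction of [Slim]. *)
rewrite (_ : (fun n => _) = (fun n => (1 + r n) * q n - r n)); last first.
  apply/funext => n; rewrite (top_shanks_recurrence _ _ _ _ _ solv_k solv_k1).
    apply: (mulIf (comp_def n i)).
    by rewrite divfK// mulrBl -mulrA /q divfK// /r !mxE; ring.
  by move=> j p jk; apply: eps_def; rewrite mul2n addn1.
rewrite (_ : 0 = (1 + rk) * (rk / (1 + rk)) - rk).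
  apply: cvgB => //; apply: cvgM; last exact: comp_cvg.
  by apply: cvgD => //; exact: cvg_cst.
by rewrite mulrCA divff// mulr1 subrr.
Qed.
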